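(* Let $p$ be an odd prime. (1) For every positive integer $k$, if $-2$ is not a square element in $\mathbb{F}_p$, then $$\sqrt{2/3}\cdot p^{2k-1}<a(3\text{-}\mathrm{AP}, \mathbb{F}_p^{4k-2})\leq p^{2k-1}.$$ (2) For every positive integer $n$, $$\sqrt{2/3}\cdot p^{n/2}<a(3\text{-}\mathrm{AP}, \mathbb{F}_p^{n})\leq a((2,-1),\mathbb{F}_p)^n.$$
   Context: A $3$-term arithmetic progression ($3$-AP) of an abelian group $G$ is a set of three distinct elements of the form $g, g+d, g+2d$ with $g,d\in G$. A subset of $G$ is $3$-AP free if it contains no $3$-AP, and complete $3$-AP free if it is $3$-AP free and not contained in a larger $3$-AP free set. $a(3\text{-}\mathrm{AP},G)$ denotes the minimum size of a complete $3$-AP free set of $G$. A set $A\subseteq G$ is $(2,-1)$-avoiding if there are no pairwise distinct $a,a',a''\in A$ with $a=2a'-a''$. It is $(2,-1)$-saturating if for each $x\in G\setminus A$ there are $a',a''\in A$, $a'\neq a''$, with $x=2a'-a''$. It is complete $(2,-1)$-avoiding if it is both. $a((2,-1),G)$ denotes the minimum size of a complete $(2,-1)$-avoiding set of $G$, with $a((2,-1),G)=\infty$ if no such set exists (e.g. for $\mathbb{F}_5$). The vector space $\mathbb{F}_p^n$ is regarded as an additive group. *)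

(* Defs.v *)
From HB Require Import structures.
From mathcomp Require Import all_boot all_order all_algebra.
From mathcomp Require Import all_classical all_reals all_analysis.

Set Implicit Arguments.
Unset Strict Implicit.
Unset Printing Implicit Defensive.

Import Order.TTheory GRing.Theory Num.Theory.
Local Open Scope ring_scope.

Definition is_3AP (G : finZmodType) (S : {set G}) : bool :=
  [exists g : G, exists d : G, S == [set g; g + d; g + d *+ 2]] && (#|S| == 3%N).

Definition AP3_free (G : finZmodType) (A : {set G}) : bool :=
  [forall S : {set G}, is_3AP S ==> ~~ (S \subset A)].

Definition complete_AP3_free (G : finZmodType) (A : {set G}) : bool :=
  maxset (@AP3_free G) A.

(* The suffix [21] stands for the coefficient vector (2,-1). *)
Definition avoiding21 (G : finZmodType) (A : {set G}) : bool :=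
  ~~ [exists a in A, exists a' in A, exists a'' in A,
        [&& a != a', a != a'', a' != a'' & a == a' *+ 2 - a'']].

Definition saturating21 (G : finZmodType) (A : {set G}) : bool :=
  [forall x in ~: A, exists a' in A, exists a'' in A,
     (a' != a'') && (x == a' *+ 2 - a'')].

Definition complete_avoiding21 (G : finZmodType) (A : {set G}) : bool :=
  avoiding21 A && saturating21 A.

(* Extended-real valued so that it is +oo when no set satisfies [P]. *)
Definition min_size (R : realType) (G : finZmodType) (P : pred {set G}) : \bar R :=
  \big[mine/+oo%E]_(A : {set G} | P A) (#|A|%:R : R)%:E.

Definition a_AP3 (R : realType) (G : finZmodType) : \bar R :=
  min_size R (@complete_AP3_free G).

Definition a_21 (R : realType) (G : finZmodType) : \bar R :=
  min_size R (@complete_avoiding21 G).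

(* Main.v *)
(* Every point outside a complete 3-AP free set [A] is a reflection [2a - b] or
   the midpoint of two points of [A]; counting both kinds of points gives the
   lower bound. For the upper bounds, a power [A^n] of a complete
   (2,-1)-avoiding set [A] of [F_p] is complete 3-AP free in [F_p^n], and so is
   the parabola [{(t, t^2)}] in [F_q^2] when [-2] is not a square in [F_q]:
   a point [(u, v)] is a midpoint of two points of the parabola when [v - u^2]
   is a nonzero square, and a reflection when [(v - u^2) / -2] is one. One takes
   [q = p^(2k-1)]: a nonsquare of [F_p] stays a nonsquare in odd degree. *)
Require Import Defs.
From HB Require Import structures.
From mathcomp Require Import all_boot all_order all_algebra.
From mathcomp Require Import all_fingroup all_solvable all_field.
From mathcomp Require Import all_classical all_reals all_analysis.
From mathcomp Require Import ring lra zify.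

Set Implicit Arguments.
Unset Strict Implicit.
Unset Printing Implicit Defensive.

Import Order.TTheory GRing.Theory Num.Theory.
Local Open Scope ring_scope.

(** * Minimum sizes as extended reals *)

(** The minimum of a nonempty finite family is attained, so a strict lower bound on all sizes passes
    to it. *)
Lemma min_sizeP (R : realType) (G : finZmodType) (P : pred {set G}) :
  min_size R P = +oo%E \/
  exists2 A : {set G}, P A & min_size R P = (#|A|%:R : R)%:E.
Proof.
rewrite /min_size.
apply: (big_ind (fun x => x = +oo%E \/
  exists2 A : {set G}, P A & x = (#|A|%:R : R)%:E)); first by left.
  move=> x y Kx Ky; case: (leP x y) => _; [exact: Kx | exact: Ky].
by move=> A PA; right; exists A.
Qed.

Lemma min_size_le (R : realType) (G : finZmodType) (P : pred {set G})
  (A : {set G}) : P A -> (min_size R P <= (#|A|%:R : R)%:E)%E.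
Proof. by move=> PA; rewrite /min_size bigmin_le_cond. Qed.

Lemma lt_min_size (R : realType) (G : finZmodType) (P : pred {set G}) (x : R) :
  (forall A, P A -> x < #|A|%:R) -> (x%:E < min_size R P)%E.
Proof.
move=> ltx; have [->|[A PA ->]] := min_sizeP R P; first by rewrite ltry.
by rewrite lte_fin ltx.
Qed.

(** * Progressions and maximality when doubling is injective *)

Section ArithmeticProgressions.

Variable G : finZmodType.
Hypothesis mul2I : injective (fun x : G => x *+ 2).
Implicit Types (A : {set G}) (a b c x : G).

(** One inequality gives three distinct points: [a = c] would make [a] and [b] have the same
    double. *)
Lemma is_3AP_mid a b c : a + c = b *+ 2 -> a != b -> is_3AP [set a; b; c].
Proof.
move=> acb neq_ab; rewrite /is_3AP.
have def_c : c = b *+ 2 - a by rewrite -acb addrC addKr.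
have neq_bc : b != c.
  apply: contraNneq neq_ab => bc; rewrite -bc mulr2n in acb.
  by apply/eqP/(addIr b).
have neq_ac : a != c.
  apply: contraNneq neq_ab => ac; apply/eqP/mul2I.
  by rewrite -acb -ac mulr2n.
apply/andP; split.
  apply/existsP; exists a; apply/existsP; exists (b - a).
  rewrite addrC subrK (_ : a + (b - a) *+ 2 = c) //.
  by rewrite def_c mulrnBl mulr2n [a *+ 2]mulr2n opprD !addrA [a + _]addrC
    -!addrA (addrC a) !addrA subrK.
rewrite -finset.setUA cardsU1 cards2 !inE negb_or neq_ab neq_ac neq_bc //.
Qed.

Lemma AP3_freeP A :
  AP3_free A <->
  (forall a b c, a \in A -> b \in A -> c \in A -> a + c = b *+ 2 -> a = b).
Proof.
split=> [/forallP free a b c aA bA cA acb | free].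
  apply/eqP; apply: contraT => neq_ab.
  have /implyP/(_ (is_3AP_mid acb neq_ab)) := free [set a; b; c].
  case/negP; apply/fintype.subsetP => x.
  by rewrite !inE => /orP[/orP[]|] /eqP->.
apply/forallP => S; apply/implyP => /andP[/existsP[g /existsP[d /eqP->]] card3].
apply/negP => /fintype.subsetP sub.
have eq3 : g + (g + d *+ 2) = (g + d) *+ 2 by rewrite !mulr2n addrACA -addrA.
have := free g (g + d) (g + d *+ 2); rewrite !sub ?inE ?eqxx ?orbT //.
move=> /(_ isT isT isT eq3)/eqP; rewrite addrC -subr_eq subrr => /eqP d0.
by move: card3; rewrite -d0 mul0rn !addr0 !finset.setUid cards1.
Qed.

(** If adding [x] creates a progression, it contains [x] as an end or as the middle, and its other
    two points lie in [A]. Conversely, in a larger free set either equation would force [x = a]. *)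
Lemma complete_AP3_freeP A :
  complete_AP3_free A <->
  AP3_free A /\
  (forall x, x \notin A -> exists a b, [/\ a \in A, b \in A, a != b &
     x + b = a *+ 2 \/ a + b = x *+ 2]).
Proof.
split=> [/maxsetP[freeA maxA] | [freeA satA]].
  split=> // x xNA.
  case: (boolP (AP3_free (x |: A))) => [/maxA/(_ (finset.subsetUr _ _)) eqA |].
    by rewrite -eqA finset.setU11 in xNA.
  case/forallPn => S; rewrite negb_imply negbK => /andP[].
  move=> /andP[/existsP[g /existsP[d /eqP defS]] card3] sub.
  have inA y : y \in S -> y != x -> y \in A.
    move=> /(fintype.subsetP sub); rewrite !inE => /orP[/eqP->|->] //.
    by rewrite eqxx.
  have xS : x \in S.
    apply: contraT => xNS; move/forallP/(_ S)/implyP: freeA => freeS.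
    have is3 : is_3AP S.
      by rewrite /is_3AP card3 andbT; apply/existsP; exists g; apply/existsP;
         exists d; apply/eqP.
    case/negP: (freeS is3); apply/fintype.subsetP => y yS.
    by apply: inA => //; apply: contraNneq xNS => <-.
  set b := g + d in defS; set c := g + d *+ 2 in defS.
  have gcb : g + c = b *+ 2 by rewrite /b /c !mulr2n addrACA -addrA.
  have gS : g \in S by rewrite defS !inE eqxx.
  have bS : b \in S by rewrite defS !inE eqxx !orbT.
  have cS : c \in S by rewrite defS !inE eqxx !orbT.
  have [gb gc bc] : [/\ g != b, g != c & b != c].
    move: card3; rewrite defS -finset.setUA cardsU1 cards2 !inE negb_or.
    by case: (g == b); case: (g == c); case: (b == c).
  (* The cases place [x] first, in the middle or last; both ends give a reflection. *)
  move: xS; rewrite {1}defS !inE => /orP[/orP[]|] /eqP ex; rewrite ex in inA *.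
  - by exists b, c; split; [apply: inA; rewrite // eq_sym..| |left].
  - by exists g, c; split; [apply: inA; rewrite // eq_sym..| |right].
  - exists b, g; split; [by apply: inA.. | by rewrite eq_sym|].
    by left; rewrite addrC.
apply/maxsetP; split=> // B freeB sAB; apply/eqP.
rewrite finset.eqEsubset sAB andbT.
apply/fintype.subsetP => x xB; apply: contraT => xNA.
have [a [b [aA bA neq_ab]]] := satA x xNA.
move/AP3_freeP: freeB => freeB.
have [aB bB] := (fintype.subsetP sAB _ aA, fintype.subsetP sAB _ bA).
case=> E; first by rewrite (freeB _ _ _ xB aB bB E) aA in xNA.
by rewrite -(freeB _ _ _ aB xB bB E) aA in xNA.
Qed.

(* [G] is covered by the points [2a - b] ([a = b] giving [A] itself) and the
   midpoints of the unordered pairs of points of [A]. *)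
Lemma complete_AP3_free_card A :
  complete_AP3_free A -> (2 * #|G| < 3 * #|A| ^ 2)%N.
Proof.
move=> /complete_AP3_freeP[_ satA].
pose ends := [set u.1 *+ 2 - u.2 | u in finset.setX A A].
(* Midpoints are counted through their doubles, which are sums over two-element subsets of [A]; this
   gives a binomial coefficient instead of a square. *)
pose sums := [set \sum_(b in B) b | B : {set G} in
                [set B : {set G} | (B \subset A) && (#|B| == 2%N)]].
pose mids := [set x | x *+ 2 \in sums].
have cover : [set: G] \subset ends :|: mids.
  apply/fintype.subsetP => x _; rewrite inE.
  case: (boolP (x \in A)) => [xA|/satA].
    apply/orP; left; apply/imsetP; exists (x, x); rewrite ?inE ?xA //=.
    by rewrite mulr2n addrK.
  move=> [a [b [aA bA neq_ab]]] [E|E].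
    apply/orP; left; apply/imsetP; exists (a, b); rewrite ?inE ?aA //=.
    by rewrite -E addrK.
  apply/orP; right; rewrite inE; apply/imsetP; exists [set a; b].
    by rewrite inE finset.subUset !finset.sub1set aA bA cards2 neq_ab.
  by rewrite -E big_setU1 ?big_set1 // inE.
have card_ends : (#|ends| <= #|A| ^ 2)%N.
  by apply: leq_trans (leq_imset_card _ _) _; rewrite cardsX mulnn.
have card_mids : (#|mids| <= 'C(#|A|, 2))%N.
  rewrite -cards_draws; apply: leq_trans (leq_imset_card _ _ : #|sums| <= _)%N.
  rewrite -(card_imset mids mul2I); apply/subset_leq_card/fintype.subsetP => y.
  by case/imsetP => x; rewrite inE => ? ->.
have := leq_trans (subset_leq_card cover) (leq_card_setU _ _).
rewrite cardsT => cardG.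
have G0 : (0 < #|G|)%N by apply/card_gt0P; exists 0.
have bin2E : (2 * 'C(#|A|, 2) = #|A| * #|A|.-1)%N.
  by rewrite -mul_bin_diag bin1.
(* With [m] the size of [A], the bound reads [2 * #|G| <= 3 * m ^ 2 - m]. It is strict because [G]
   is nonempty, which forces [m > 0]. *)
have := leq_trans G0 (leq_trans cardG (leq_add card_ends card_mids)).
have := leq_trans cardG (leq_add card_ends card_mids).
case: #|A| bin2E => [|m] /=; first by rewrite bin0n.
nia.
Qed.

End ArithmeticProgressions.

(** * The lower bound *)

Lemma sqrt23_lt (R : realType) (s : R) (q m : nat) :
  0 <= s -> s ^+ 2 = q%:R -> (2 * q < 3 * m ^ 2)%N ->
  Num.sqrt (2 / 3) * s < m%:R.
Proof.
move=> s0 sq qm; rewrite -(@ltr_pXn2r _ 2) ?nnegrE ?mulr_ge0 ?sqrtr_ge0 //.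
rewrite exprMn sqr_sqrtr ?divr_ge0 // sq -natrX.
have : (2 * q)%:R < (3 * m ^ 2)%:R :> R by rewrite ltr_nat.
rewrite !natrM; lra.
Qed.

Lemma Fp_two_neq0 (p : nat) : prime p -> odd p -> 2%:R != 0 :> 'F_p.
Proof.
move=> p_prime p_odd; rewrite -(dvdn_pcharf (pchar_Fp p_prime)).
by rewrite gtnNdvd // odd_prime_gt2.
Qed.

Lemma mul2I_lmod (F : fieldType) (V : lmodType F) :
  2%:R != 0 :> F -> injective (fun v : V => v *+ 2).
Proof. by move=> F2 u v /=; rewrite -!(scaler_nat 2) => /(scalerI F2). Qed.

(** The root of [p ^ n] enters as any nonnegative [s], so that an integer power and a real power of
    [p] both fit. *)
Lemma a_AP3_gt (R : realType) (p n : nat) (s : R) :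
  prime p -> odd p -> 0 <= s -> s ^+ 2 = (p ^ n)%:R ->
  ((Num.sqrt (2 / 3) * s)%:E < a_AP3 R 'rV['F_p]_n)%E.
Proof.
move=> p_prime p_odd s0 sn; apply: lt_min_size => A complA.
apply: (sqrt23_lt s0 sn).
have := complete_AP3_free_card (mul2I_lmod (Fp_two_neq0 p_prime p_odd)) complA.
by rewrite card_mx card_Fp // mul1n.
Qed.

(** * Powers of complete (2,-1)-avoiding sets *)

Definition row_power (F : finFieldType) (n : nat) (A : {set F}) :
  {set 'rV[F]_n} := [set v : 'rV[F]_n | [forall i, v 0 i \in A]].

Lemma card_row_power (F : finFieldType) (n : nat) (A : {set F}) :
  #|row_power n A| = (#|A| ^ n)%N.
Proof.
rewrite -[n in RHS]card_ord -card_ffun_on.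
rewrite -(@card_imset _ _ (fun f : {ffun 'I_n -> F} => \row_i f i)); last first.
  by move=> f g /rowP fg; apply/ffunP => i; have := fg i; rewrite !mxE.
apply: eq_card => v; rewrite inE.
apply/forallP/imsetP => [vA | [f /ffun_onP fA ->] i].
  exists [ffun i => v 0 i]; first by apply/ffun_onP => i; rewrite ffunE.
  by apply/rowP => i; rewrite !mxE ffunE.
by rewrite mxE.
Qed.

Lemma complete_row_power (F : finFieldType) (n : nat) (A : {set F}) :
  2%:R != 0 :> F -> complete_avoiding21 A -> complete_AP3_free (row_power n A).
Proof.
move=> F2 /andP[avoidA /forallP satA].
have mul2I := @mul2I_lmod F F^o F2.
apply/(complete_AP3_freeP (mul2I_lmod F2)); split.
  apply/(AP3_freeP (mul2I_lmod F2)) => a b c.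
  rewrite !inE => /forallP aA /forallP bA /forallP cA abc; apply/rowP => i.
  apply/eqP; apply: contraNT avoidA => neq_ab.
  have /rowP/(_ i) := abc; rewrite mulmxnE mxE => abci.
  apply/existsP; exists (a 0 i); rewrite aA /=.
  apply/existsP; exists (b 0 i); rewrite bA /=.
  apply/existsP; exists (c 0 i); rewrite cA /= neq_ab /=.
  rewrite -abci addrK eqxx andbT; apply/andP; split.
    apply: contraNneq neq_ab => ac; rewrite -ac in abci.
    by apply/eqP/mul2I; rewrite -abci mulr2n.
  apply: contraNneq neq_ab => bc; rewrite -bc mulr2n in abci.
  by apply/eqP/(addIr (b 0 i)).
move=> x xNA.
(* A coordinate already in [A] uses the trivial [x = 2x - x]. The last clause makes the two vectors
   differ, since some coordinate of [x] lies outside [A]. *)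
have coord i : exists u : F * F, [/\ u.1 \in A, u.2 \in A,
    x 0 i = u.1 *+ 2 - u.2 & (u.1 == u.2) = (x 0 i \in A)].
  case: (boolP (x 0 i \in A)) => [xA|xiNA].
    by exists (x 0 i, x 0 i); rewrite /= eqxx mulr2n addrK.
  have := satA (x 0 i); rewrite inE xiNA => /existsP[a /andP[aA]].
  by case/existsP => b /and3P[bA /negPf ab /eqP E]; exists (a, b).
have [f fP] := fin_all_exists coord.
exists (\row_i (f i).1), (\row_i (f i).2); split.
- by rewrite inE; apply/forallP => i; rewrite mxE; case: (fP i).
- by rewrite inE; apply/forallP => i; rewrite mxE; case: (fP i).
- apply: contraNneq xNA => /rowP E; rewrite inE; apply/forallP => i.
  by case: (fP i) => _ _ _ <-; have := E i; rewrite !mxE => ->.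
- left; apply/rowP => i; rewrite mulmxnE !mxE.
  by case: (fP i) => _ _ -> _; rewrite subrK.
Qed.

(** * Squares in finite fields *)

(** The unit group is cyclic and the nonsquare [c] is an odd power of a generator, so the parity of
    the exponent of [w] decides the case. *)
Lemma finField_square_or (F : finFieldType) (c w : F) :
  (forall x, x ^+ 2 != c) -> exists t, w = t ^+ 2 \/ w = c * t ^+ 2.
Proof.
move=> nsq.
have [->|w0] := eqVneq w 0; first by exists 0; left; rewrite expr0n.
have c0 : c != 0 by apply: contraTneq (nsq 0) => ->; rewrite expr0n eqxx.
have /cyclicP[g gen] := field_unit_group_cyclic [set: {unit F}]%G.
have power v : v != 0 -> exists i, v = val g ^+ i.
  move=> v0; have vU : v \is a GRing.unit by rewrite unitfE.
  have /cycleP[i E] : FinRing.unit F vU \in <[g]>%g by rewrite -gen inE.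
  by exists i; rewrite -FinRing.val_unitX -E.
have [[i wi] [j cj]] := (power w w0, power c c0).
have sqr_even k : ~~ odd k -> val g ^+ k = (val g ^+ k./2) ^+ 2.
  by move=> k_even; rewrite -exprM muln2 even_halfK.
have j_odd : odd j.
  apply: contraT => /sqr_even E.
  by have := nsq (val g ^+ j./2); rewrite cj E eqxx.
case: (boolP (odd i)) => [i_odd | i_even].
  (* As [i + j] is even, [w * c] is a square; dividing it by [c ^+ 2] gives [w / c]. *)
  exists (val g ^+ (i + j)./2 / c); right.
  rewrite expr_div_n -sqr_even ?oddD ?i_odd ?j_odd // exprD -wi -cj.
  by field.
by exists (val g ^+ i./2); left; rewrite -sqr_even.
Qed.

(** ['X^p - 'X] splits over the prime field as the product of all ['X - a], so it has no further
    roots in [F]. *)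
Lemma Frobenius_fixed (F : finFieldType) (p : nat) (pcharF : p \in [pchar F])
  (x : F) : x ^+ p = x -> exists a : 'F_p, x = (a : nat)%:R.
Proof.
move=> xp; pose L := pPrimeCharType pcharF.
have p_prime := pcharf_prime pcharF.
have : root (map_poly (in_alg L) ('X^p - 'X)) x.
  by rewrite rmorphB /= map_polyXn map_polyX rootE !hornerE xp subrr.
rewrite -[p in 'X^p]card_Fp // finField_genPoly rmorph_prod rootE horner_prod.
move=> /eqP/eqP/prodf_eq0[a _]; rewrite rmorphB /= map_polyX map_polyC !hornerE.
rewrite subr_eq0 => /eqP ->; exists a; exact: mulr1.
Qed.

(* Frobenius sends a square root [x] of [- c] to [x] or [- x]: it lies in the
   prime field in the first case, and [x ^+ (p ^ m) = - x] for odd [m] in the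
   second. *)
Lemma nonsquare_odd_ext (F : finFieldType) (p m c : nat) :
  p \in [pchar F] -> 2%:R != 0 :> F -> #|F| = (p ^ m)%N -> odd m ->
  ~ (exists x : 'F_p, x ^+ 2 = - c%:R) -> forall x : F, x ^+ 2 != - c%:R.
Proof.
move=> pcharF F2 cardF m_odd nsq x; apply/eqP => x2.
have p_prime := pcharf_prime pcharF.
have xp_nsq : x ^+ p <> x.
  move=> /(Frobenius_fixed pcharF)[a xa]; case: nsq; exists a.
  (* In [F] and in ['F_p] alike, the natural number [a ^ 2 + c] vanishes exactly when [p] divides
     it. *)
  apply/eqP; rewrite -addr_eq0 -(natr_Zp a) -natrX -natrD.
  rewrite -(dvdn_pcharf (pchar_Fp p_prime)) (dvdn_pcharf pcharF).
  by rewrite natrD natrX -xa x2 addNr.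
have : x ^+ p = - x.
  suff : (x ^+ p == x) || (x ^+ p == - x) by case/orP => /eqP // /xp_nsq.
  rewrite -eqf_sqr -exprM mulnC exprM x2.
  by rewrite -(pFrobenius_autE pcharF) rmorphN rmorph_nat.
rewrite -(pFrobenius_autE pcharF) => xN.
have iterN k : x ^+ (p ^ k) = (-1) ^+ k * x.
  elim: k => [|k IH]; first by rewrite expn0 expr1 mul1r.
  rewrite expnSr exprM IH -(pFrobenius_autE pcharF) rmorphM rmorph_sign /= xN.
  by rewrite exprSr mulrAC mulrN mulrN1.
(* The power [p ^ m] fixes all of [F], so [x = - x] and [x = 0]; but Frobenius fixes [0], against
   [xp_nsq]. *)
have := expf_card x; rewrite cardF iterN -signr_odd m_odd expr1 mulN1r => /eqP.
rewrite eq_sym -addr_eq0 -mulr2n -mulr_natl mulf_eq0 (negPf F2) /= => /eqP x0.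
by case: xp_nsq; rewrite x0 expr0n; case: (p) p_prime.
Qed.

(** * The parabola in a plane over a finite field *)

Section Parabola.

Variables (F : finFieldType) (G : finZmodType) (f : F * F -> G).
Hypotheses (fD : forall u v, f (u + v) = f u + f v) (f_bij : bijective f).
Hypotheses (F2 : 2%:R != 0 :> F) (nsq : forall x : F, x ^+ 2 != - 2%:R).

(** The additive bijection [f] moves the parabola out of [F * F]; the target will be a space of row
    vectors over the prime field. *)
Definition parabola : {set G} := [set f (t, t ^+ 2) | t : F].

Lemma card_parabola : #|parabola| = #|F|.
Proof. by rewrite card_imset // => s t /(bij_inj f_bij)[]. Qed.

Lemma complete_parabola : complete_AP3_free parabola.
Proof.
have f_inj := bij_inj f_bij.
have mul2I : injective (fun x : G => x *+ 2).
  have [g gK fK] := f_bij => x y; rewrite -(fK x) -(fK y) /= !mulr2n -!fD.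
  move=> /f_inj[]; rewrite -!mulr2n.
  move=> /(@mul2I_lmod F F^o F2) E1 /(@mul2I_lmod F F^o F2) E2.
  by congr f; rewrite [g x]surjective_pairing E1 E2 -surjective_pairing.
apply/(complete_AP3_freeP mul2I); split.
  apply/(AP3_freeP mul2I) 
    => _ _ _ /imsetP[a _ ->] /imsetP[b _ ->] /imsetP[c _ ->].
  rewrite mulr2n -!fD => /f_inj[E1 E2]; suff -> : a = b by [].
  have c_def : c = b + b - a by rewrite -E1 addrC addKr.
  (* Substituting [c = 2b - a] into [a^2 + c^2 = 2b^2] leaves this perfect square. *)
  have /eqP : 2%:R * (a - b) ^+ 2 = 0.
    by move/eqP: E2; rewrite c_def -subr_eq0 => /eqP <-; ring.
  by rewrite mulf_eq0 (negPf F2) expf_eq0 /= subr_eq0 => /eqP.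
have [g gK fK] := f_bij => x; rewrite -(fK x); case: (g x) => u v xNA {x}.
have v_neq : v - u ^+ 2 != 0.
  by apply: contraNneq xNA => /subr0_eq ->; apply: imset_f.
have [t tP] := finField_square_or (v - u ^+ 2) nsq.
have t0 : t != 0.
  by apply: contraNneq v_neq => t0; case: tP => ->; rewrite t0 expr0n ?mulr0.
have shift s s' : s != s' ->
    f (u + s, (u + s) ^+ 2) != f (u + s', (u + s') ^+ 2).
  by apply: contraNneq => /f_inj[/addrI ->].
case: tP => /(canRL (subrK _)) E.
  (* Midpoint case: the squares of [u + t] and [u - t] have mean [u^2 + t^2 = v]. *)
  exists (f (u + t, (u + t) ^+ 2)), (f (u + - t, (u + - t) ^+ 2)).
  split; [exact: imset_f | exact: imset_f | apply: shift |].
    by rewrite -addr_eq0 -mulr2n -mulr_natl mulf_neq0.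
  right; rewrite mulr2n -!fD; congr f.
  by apply: (f_equal2 pair); rewrite /= ?E; ring.
(* Reflection case: [2(u + t)^2 - (u + 2t)^2 = u^2 - 2t^2 = v]. *)
exists (f (u + t, (u + t) ^+ 2)), (f (u + (t + t), (u + (t + t)) ^+ 2)).
split; [exact: imset_f | exact: imset_f | apply: shift |].
  by apply: contraNneq t0 => tt; apply/eqP/(addrI t); rewrite addr0.
left; rewrite mulr2n -!fD; congr f.
by apply: (f_equal2 pair); rewrite /= ?E; ring.
Qed.

End Parabola.

(** * Transfer to vector spaces over the prime field *)

Lemma finField_pair_rV (F : finFieldType) (p m : nat) :
  p \in [pchar F] -> #|F| = (p ^ m)%N ->
  exists f : F * F -> 'rV['F_p]_(m + m),
    (forall u v, f (u + v) = f u + f v) /\ bijective f.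
Proof.
move=> pcharF cardF; have [g g_lin g_bij] := pprimeChar_vectAxiom pcharF.
(* The dimension of [F] over ['F_p] comes as the [p]-adic valuation of its cardinal, which is
   [m]. *)
rewrite /= cardF pfactorK ?(pcharf_prime pcharF) // in g g_lin g_bij.
have gD u v : g (u + v) = g u + g v by have := g_lin 1 u v; rewrite !scale1r.
exists (fun u => row_mx (g u.1) (g u.2)); split=> [u v|].
  by rewrite add_row_mx -!gD.
have [h gK hK] := g_bij.
exists (fun w => (h (lsubmx w), h (rsubmx w))) => [[u v]|w] /=.
  by rewrite row_mxKl row_mxKr !gK.
by rewrite !hK hsubmxK.
Qed.

Lemma a_AP3_le_parabola (R : realType) (p m : nat) :
  prime p -> odd p -> odd m -> ~ (exists x : 'F_p, x ^+ 2 = - 2%:R) ->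
  (a_AP3 R 'rV['F_p]_(m + m) <= (p%:R ^+ m : R)%:E)%E.
Proof.
move=> p_prime p_odd m_odd nsq.
have [F pcharF cardF] := pPrimePowerField p_prime (odd_gt0 m_odd).
have F2 : 2%:R != 0 :> F.
  by rewrite -(dvdn_pcharf pcharF) gtnNdvd // odd_prime_gt2.
have [f [fD f_bij]] := finField_pair_rV pcharF cardF.
have nsqF := nonsquare_odd_ext pcharF F2 cardF m_odd nsq.
rewrite -natrX -cardF -(card_parabola f_bij).
exact/min_size_le/complete_parabola.
Qed.

Lemma a_AP3_le_power (R : realType) (p n : nat) :
  prime p -> odd p -> (0 < n)%N ->
  (a_AP3 R 'rV['F_p]_n <= a_21 R 'F_p ^+ n)%E.
Proof.
move=> p_prime p_odd n_gt0.
have [E|[A complA E]] := min_sizeP R (@complete_avoiding21 'F_p).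
  (* Without a complete (2,-1)-avoiding set the bound is infinite; [n > 0] matters, as a zeroth
     power would be 1. *)
  rewrite /a_21 E (_ : (+oo ^+ n)%E = +oo%E) ?leey //.
  case: n n_gt0 => // n _; elim: n => [|n IH]; rewrite ?expe1 //.
  by rewrite expeS IH mulyy.
rewrite /a_21 E -EFin_expe -natrX -card_row_power.
exact/min_size_le/complete_row_power/complA/Fp_two_neq0.
Qed.

Theorem theorem1p11 (R : realType) (p : nat) (p_prime : prime p) (p_odd : odd p) :
  (forall k : nat, (0 < k)%N ->
     ~ (exists x : 'F_p, x ^+ 2 = - 2%:R) ->
     ((Num.sqrt (2 / 3) * p%:R ^+ (2 * k - 1) : R)%:E
        < a_AP3 R 'rV['F_p]_(4 * k - 2))%E
     /\ (a_AP3 R 'rV['F_p]_(4 * k - 2) <= (p%:R ^+ (2 * k - 1) : R)%:E)%E)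
  /\
  (forall n : nat, (0 < n)%N ->
     ((Num.sqrt (2 / 3) * p%:R `^ (n%:R / 2) : R)%:E < a_AP3 R 'rV['F_p]_n)%E
     /\ (a_AP3 R 'rV['F_p]_n <= a_21 R 'F_p ^+ n)%E).
Proof.
split=> [k k_gt0 nsq | n n_gt0]; split.
- apply: a_AP3_gt => //; rewrite natrX -exprM.
  by congr (_ ^+ _); lia.
- rewrite (_ : (4 * k - 2 = (2 * k - 1) + (2 * k - 1))%N); last by lia.
  (* Subtraction is truncated, so the oddness of [2 * k - 1] rests on [k > 0]. *)
  by apply: a_AP3_le_parabola => //; lia.
- apply: a_AP3_gt => //.
  rewrite -powR_mulrn ?powR_ge0 // -powRrM natrX -powR_mulrn //.
  by congr (_ `^ _); field.
- exact: a_AP3_le_power.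
Qed.
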